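(* Let $V=\bigl\{\sum_{s\in\mathbb S}\alpha(s)v^\pi(s):\ \pi\in\Pi\bigr\}\subseteq\mathbb R^k$ be the value set of the vector maximization program (vMDP), and let $$V'=\Bigl\{\sum_{t=1}^{T-1}\sum_{s\in\mathbb S}\sum_{a\in\mathbb A_s}x_t(s,a)R_t(s,a)+\sum_{s\in\mathbb S}x_T(s)R_T(s):\ x\in P\Bigr\}$$ be the value set of the vector linear program (vLP). Then $V'=V$. Furthermore, a policy $\pi\in\Pi$ is efficient for (vMDP) if and only if $x_\pi\in P$ is an efficient solution of (vLP).
   Context: Order and efficiency. $\geqq$ is the componentwise order on $\mathbb R^k$. An element $v$ of $V\subseteq\mathbb R^k$ is efficient in $V$ if there is no $v'\in V$, $v'\neq v$, with $v'\geqq v$. For a problem of vector-maximizing $f:X\to\mathbb R^k$ over a set $X$, the value set is $f(X)$, and $x^*\in X$ is an efficient solution if $f(x^* )$ is efficient in $f(X)$. Model (vMDP). Integers $T\geq 2$, $S\ge 1$, $k\geq 1$; states $\mathbb S=\{1,\dots,S\}$; action sets $\mathbb A_s=\{1,\dots,k_s\}$ with $k_s\ge1$ and $k_s>1$ for at least one $s$; transition probabilities $p_t(j|s,a)$ for $t=1,\dots,T-1$, $s,j\in\mathbb S$, $a\in\mathbb A_s$ (nonnegative, summing to 1 over $j$); rewards $R_t(s,a)\in\mathbb R^k$ ($t<T$) and terminal rewards $R_T(s)\in\mathbb R^k$; initial probabilities $\alpha(s)>0$ with $\sum_{s}\alpha(s)=1$. A policy is $\pi=(\pi_1,\dots,\pi_{T-1})$,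 where each decision rule $\pi_t$ assigns to each state $s$ a probability distribution $q(\cdot\,|\,s,\pi_t)$ on $\mathbb A_s$. $\Pi$ is the set of all policies. Each $\pi$ induces a probability measure $\mathbb P^\pi$ on trajectories $(\mathbf S_1,\mathbf A_1,\dots,\mathbf S_{T-1},\mathbf A_{T-1},\mathbf S_T)$: $\mathbf S_1$ has law $\alpha$; given the past and $\mathbf S_t=s$, $\mathbf A_t=a$ with probability $q(a|s,\pi_t)$; given the past, $\mathbf S_t=s$ and $\mathbf A_t=a$, $\mathbf S_{t+1}=j$ with probability $p_t(j|s,a)$. The value is $v^\pi(s)=\mathbb E^\pi\bigl[\sum_{t=1}^{T-1}R_t(\mathbf S_t,\mathbf A_t)+R_T(\mathbf S_T)\,\big|\,\mathbf S_1=s\bigr]\in\mathbb R^k$. Program (vMDP) is: vector-maximize $\sum_{s}\alpha(s)v^\pi(s)$ over $\pi\in\Pi$; its efficient solutions are called efficient policies. State-action frequencies. For $\pi\in\Pi$, $x_\pi$ has components $x_{\pi,t}(s,a)=\sum_{j}\alpha(j)\mathbb P^\pi(\mathbf S_t=s,\mathbf A_t=a|\mathbf S_1=j)$ for $t=1,\dots,T-1$, and $x_{\pi,T}(s)=\sum_j\alpha(j)\mathbb P^\pi(\mathbf S_T=s|\mathbf S_1=j)$. $P$ is the set of all vectors $x\geqq0$ with components $x_t(s,a)$ ($t\le T-1$, $s\in\mathbb S$, $a\in\mathbb A_s$) and $x_T(s)$ satisfying (a) $\sum_{a\in\mathbb A_j}x_1(j,a)=\alpha(j)$ for all $j$; (b)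 $\sum_{a\in\mathbb A_j}x_{t+1}(j,a)=\sum_{s}\sum_{a\in\mathbb A_s}p_t(j|s,a)x_t(s,a)$ for all $j$ and $t=1,\dots,T-2$; (c) $x_T(j)=\sum_{s}\sum_{a\in\mathbb A_s}p_{T-1}(j|s,a)x_{T-1}(s,a)$ for all $j$. Program (vLP) is: vector-maximize $\sum_{t=1}^{T-1}\sum_{s}\sum_{a}x_t(s,a)R_t(s,a)+\sum_s x_T(s)R_T(s)$ over $x\in P$. *)

(* Defs.v *)
From HB Require Import structures.
From mathcomp Require Import all_boot all_order all_algebra.
From mathcomp Require Import boolp classical_sets reals.

Set Implicit Arguments.
Unset Strict Implicit.
Unset Printing Implicit Defensive.

Import Order.TTheory GRing.Theory Num.Theory.

Local Open Scope classical_set_scope.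
Local Open Scope ring_scope.

(** Vector maximization with respect to the componentwise order. *)

Definition vgeq (R : realType) (k : nat) (u v : 'rV[R]_k) : Prop :=
  forall i, v 0 i <= u 0 i.

Definition efficient (R : realType) (k : nat) (V : set 'rV[R]_k)
    (v : 'rV[R]_k) : Prop :=
  V v /\ ~ (exists v', [/\ V v', v' <> v & vgeq v' v]).

Definition value_set (R : realType) (k : nat) (X : Type) (D : set X)
    (f : X -> 'rV[R]_k) : set 'rV[R]_k := f @` D.

Definition efficient_solution (R : realType) (k : nat) (X : Type) (D : set X)
    (f : X -> 'rV[R]_k) (x : X) : Prop :=
  D x /\ efficient (value_set D f) (f x).

(** Time is counted from 0: [t : 'I_(horizon M).-1] is the decision epoch
    usually written t+1, with 1 <= t+1 <= T-1 and T = [horizon M].  Similarly,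
    states are 0, ..., S-1, and actions in state s are 0, ..., k_s - 1. *)
Record vMDP (R : realType) := {
  horizon : nat;
  nstates : nat;
  dim : nat;
  nact : 'I_nstates -> nat;
  trans : 'I_horizon.-1 -> forall s : 'I_nstates, 'I_(nact s) ->
    'I_nstates -> R;
  reward : 'I_horizon.-1 -> forall s : 'I_nstates, 'I_(nact s) ->
    'rV[R]_dim;
  treward : 'I_nstates -> 'rV[R]_dim;
  init : 'I_nstates -> R;
  horizon_ge2 : (2 <= horizon)%N;
  nstates_ge1 : (1 <= nstates)%N;
  dim_ge1 : (1 <= dim)%N;
  nact_ge1 : forall s, (1 <= nact s)%N;
  nact_gt1 : exists s, (1 < nact s)%N;
  trans_ge0 : forall t s a j, 0 <= trans t (s := s) a j;
  trans_sum1 : forall t s a, \sum_j trans t (s := s) a j = 1;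
  init_gt0 : forall s, 0 < init s;
  init_sum1 : \sum_s init s = 1
}.

Section Model.
Variables (R : realType) (M : vMDP R).

Notation epoch := 'I_(horizon M).-1.
Notation state := 'I_(nstates M).
Notation action s := 'I_(nact (v := M) s).

(** [rule pi t s a] is q(a | s, pi_t). *)
Record policy := {
  rule : epoch -> forall s : state, action s -> R;
  rule_ge0 : forall t s a, 0 <= rule t (s := s) a;
  rule_sum1 : forall t s, \sum_a rule t (s := s) a = 1
}.

Definition sapair : finType := {s : state & action s}.

(** A trajectory: the pairs (S_t, A_t) with A_t an action available in S_t,
    followed by the terminal state. *)
Definition traj : finType := ({ffun epoch -> sapair} * state)%type.

(** [state_at w n] is the state at the 0-based time n; it is the terminal state
    for n = T-1 (values n >= T are not used). *)
Definition state_at (w : traj) (n : nat) : state :=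
  if insub n is Some t then tag (w.1 t) else w.2.

(** The mass function of P^pi: by the chain rule, the product of the law of S_1
    and of the conditional laws of A_t given S_t and S_{t+1} given S_t, A_t. *)
Definition traj_prob (pi : policy) (w : traj) : R :=
  init (state_at w 0) *
  \prod_(t < (horizon M).-1)
    (rule pi t (tagged (w.1 t)) *
     trans t (tagged (w.1 t)) (state_at w t.+1)).

Definition prob (pi : policy) (E : pred traj) : R :=
  \sum_(w | E w) traj_prob pi w.

(** Conditioning is only used on the events S_1 = j, which have probability
    [init j > 0]. *)
Definition cond_prob (pi : policy) (E F : pred traj) : R :=
  prob pi (predI E F) / prob pi F.

Definition cond_exp (pi : policy) (f : traj -> 'rV[R]_(dim M))
    (F : pred traj) : 'rV[R]_(dim M) :=
  (prob pi F)^-1 *: \sum_(w | F w) traj_prob pi w *: f w.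

Definition starts_in (j : state) : pred traj :=
  fun w => state_at w 0 == j.

Definition visits (t : epoch) (s : state) (a : action s) : pred traj :=
  fun w => w.1 t == existT (fun s => action s) s a.

Definition ends_in (s : state) : pred traj :=
  fun w => state_at w (horizon M).-1 == s.

Definition total_reward (w : traj) : 'rV[R]_(dim M) :=
  \sum_(t < (horizon M).-1) reward t (tagged (w.1 t)) +
  treward (state_at w (horizon M).-1).

Definition value (pi : policy) (s : state) : 'rV[R]_(dim M) :=
  cond_exp pi total_reward (starts_in s).

Definition vMDP_objective (pi : policy) : 'rV[R]_(dim M) :=
  \sum_s init s *: value pi s.

Definition efficient_policy (pi : policy) : Prop :=
  efficient_solution [set: policy] vMDP_objective pi.

(** Vectors with components x_t(s,a) for t < T, and x_T(s). *)
Record freq := Freq {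
  xdec : epoch -> forall s : state, action s -> R;
  xterm : state -> R
}.

Definition freq_of (pi : policy) : freq := {|
  xdec := fun t s a =>
    \sum_j init j * cond_prob pi (visits t a) (starts_in j);
  xterm := fun s =>
    \sum_j init j * cond_prob pi (ends_in s) (starts_in j)
|}.

(** In the three balance equations the hypotheses on [t] pick out the first
    epoch, two consecutive epochs, and the last epoch respectively. *)
Record vLP_constraints (x : freq) : Prop := {
  xdec_ge0 : forall t s (a : action s), 0 <= xdec x t a;
  xterm_ge0 : forall s, 0 <= xterm x s;
  balance_init : forall (t : epoch) (j : state), t = 0%N :> nat ->
    \sum_(a < nact j) xdec x t a = init j;
  balance_step : forall (t t' : epoch) (j : state), t' = t.+1 :> nat ->
    \sum_(a < nact j) xdec x t' a =
    \sum_s \sum_(a < nact s) trans t a j * xdec x t a;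
  balance_term : forall (t : epoch) (j : state),
    t.+1 = (horizon M).-1 :> nat ->
    xterm x j = \sum_s \sum_(a < nact s) trans t a j * xdec x t a
}.

Definition vLP_feasible : set freq := [set x | vLP_constraints x].

Definition vLP_objective (x : freq) : 'rV[R]_(dim M) :=
  \sum_(t < (horizon M).-1) \sum_s \sum_(a < nact s)
    xdec x t a *: reward t a +
  \sum_s xterm x s *: treward s.

End Model.

(* Main.v *)
Require Import Defs.
From mathcomp Require Import all_boot all_order all_algebra.
From mathcomp Require Import boolp classical_sets reals.
From mathcomp Require Import ring.


(** The total reward of a trajectory is a sum of terms that each look at one
    coordinate only, so its expectation depends on a policy only through the
    laws of those coordinates, that is, through the frequency vector; this
    gives equal objective values at [pi] and [freq_of pi]
    ([vLP_objective_freq_of]).  It remains to see that the frequency vectors of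
    policies are exactly the feasible points.

    Two facts about the trajectory measure suffice: the action at time t is
    drawn from the rule at the current state ([prob_visits]), and the next
    state is drawn from the transition law of the current state-action pair
    ([prob_state_next]).  They give the balance equations for [freq_of pi]
    ([freq_of_feasible]).  Conversely a feasible x is disintegrated: the policy
    plays a in s at time t with probability x_t(s,a) / sum_b x_t(s,b).  The
    balance equations say that the state marginals of x obey the same forward
    recursion as those of this policy, so by induction on time its frequency
    vector is x ([xdec_freq_of_policy_of]).

    Hence the two value sets coincide, and since efficiency of a solution only
    involves the value set and the objective value, the equivalence for a
    policy and its frequency vector follows.

    The two facts about the measure are proved for an arbitrary finite
    time-inhomogeneous chain, by induction on its length.  The induction removes
    the first step: averaging over the first pair leaves a shorter chain whose
    initial law is the pushed-forward one ([run_exp_recl]).  For this to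
    work the initial weight has to be an arbitrary function, not a
    probability, because a test function of the first pair is absorbed in it. *)
Set Implicit Arguments.
Unset Strict Implicit.
Unset Printing Implicit Defensive.

Import Order.TTheory GRing.Theory Num.Theory.

Local Open Scope classical_set_scope.
Local Open Scope ring_scope.

(** * Finite time-inhomogeneous chains *)
Section Chain.
Variables (R : comNzRingType) (S X : finType) (st : X -> S).

Definition run n := ({ffun 'I_n -> X} * S)%type.

Definition run_state n (w : run n) (m : nat) : S :=
  if insub m is Some t then st (w.1 t) else w.2.

Definition run_weight n (mu : S -> R) (Q : 'I_n -> X -> R)
    (K : 'I_n -> X -> S -> R) (w : run n) : R :=
  mu (run_state w 0) *
  \prod_(t < n) (Q t (w.1 t) * K t (w.1 t) (run_state w t.+1)).

Definition run_exp n mu Q K (F : run n -> R) : R :=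
  \sum_w run_weight mu Q K w * F w.

Definition run_cons n (x : X) (w : run n) : run n.+1 :=
  ([ffun i => oapp w.1 x (unlift ord0 i)], w.2).

Definition push (mu : S -> R) (q : X -> R) (k : X -> S -> R) (s : S) : R :=
  \sum_x mu (st x) * q x * k x s.

Lemma run_stateE n (w : run n) (t : 'I_n) : run_state w t = st (w.1 t).
Proof. by rewrite /run_state valK. Qed.

Lemma run_consE0 n x (w : run n) : (run_cons x w).1 ord0 = x.
Proof. by rewrite ffunE unlift_none. Qed.

Lemma run_consES n x (w : run n) t : (run_cons x w).1 (lift ord0 t) = w.1 t.
Proof. by rewrite ffunE liftK. Qed.

Lemma run_state_cons0 n x (w : run n) : run_state (run_cons x w) 0 = st x.
Proof. by rewrite (run_stateE (run_cons x w) ord0) run_consE0. Qed.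

Lemma run_state_consS n x (w : run n) m :
  run_state (run_cons x w) m.+1 = run_state w m.
Proof.
rewrite {2}/run_state; case: insubP => [t _ <- | ltmF].
  by rewrite (run_stateE (run_cons x w) (lift ord0 t)) run_consES.
by rewrite /run_state insubN.
Qed.

Lemma big_run_recl n (F : run n.+1 -> R) :
  \sum_w F w = \sum_x \sum_w F (run_cons x w).
Proof.
rewrite pair_big /= (reindex (fun p : X * run n => run_cons p.1 p.2)) //.
exists (fun w : run n.+1 => (w.1 ord0, ([ffun i => w.1 (lift ord0 i)], w.2))).
  move=> [x [f s]] _ /=; rewrite ffunE unlift_none; congr (_, (_, _)).
  by apply/ffunP=> i; rewrite !ffunE liftK.
move=> [f s] _; congr (_, _); apply/ffunP=> i; rewrite ffunE /=.
by case: unliftP => [j ->|->] /=; rewrite ?ffunE.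
Qed.

(** A test function that factors into a head part [f] and a tail part [g] is
    integrated over the head first; [f] then becomes a density in the initial
    weight of the tail. *)
Lemma run_exp_recl n mu Q K (F : run n.+1 -> R) (f : X -> R)
    (g : run n -> R) :
  (forall x w, F (run_cons x w) = f x * g w) ->
  run_exp mu Q K F =
  run_exp (push mu (fun x => Q ord0 x * f x) (K ord0))
    (fun t => Q (lift ord0 t)) (fun t => K (lift ord0 t)) g.
Proof.
move=> FE; rewrite /run_exp big_run_recl exchange_big /=.
apply: eq_bigr => w _; rewrite /run_weight /push !mulr_suml.
apply: eq_bigr => x _; rewrite big_ord_recl run_state_cons0 run_consE0 FE.
rewrite run_state_consS (eq_bigr (fun t => Q (lift ord0 t) (w.1 t) *
  K (lift ord0 t) (w.1 t) (run_state w t.+1))); first by ring.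
by move=> t _; rewrite run_consES run_state_consS.
Qed.

Arguments run_exp_recl {n mu Q K F} f g.

Definition stochastic n (Q : 'I_n -> X -> R) (K : 'I_n -> X -> S -> R) :=
  (forall t s, \sum_(x | st x == s) Q t x = 1) /\
  (forall t x, \sum_s K t x s = 1).

Lemma stochastic_shift n (Q : 'I_n.+1 -> X -> R) K : stochastic Q K ->
  stochastic (fun t => Q (lift ord0 t)) (fun t => K (lift ord0 t)).
Proof. by case=> Q1 K1; split=> *. Qed.

Lemma sum_by_state (F : X -> R) :
  \sum_x F x = \sum_s \sum_(x | st x == s) F x.
Proof. by rewrite (partition_big st predT). Qed.

Lemma sum_push mu q k (g : S -> R) :
  \sum_s push mu q k s * g s =
  \sum_x mu (st x) * q x * \sum_s k x s * g s.
Proof.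
under eq_bigr do rewrite mulr_suml.
rewrite exchange_big; apply: eq_bigr => x _; rewrite mulr_sumr.
by apply: eq_bigr => s _; rewrite mulrA.
Qed.

Lemma push_mass mu q k : (forall x, \sum_s k x s = 1) ->
  \sum_s push mu q k s * 1 = \sum_x mu (st x) * q x.
Proof.
move=> k1; rewrite (sum_push _ _ _ (fun=> 1)); apply: eq_bigr => x _.
by under eq_bigr do rewrite mulr1; rewrite k1 mulr1.
Qed.

(** The steps after time 0 integrate to 1.  The induction needs [mu] general:
    after removal of the first pair, [g] sits in the new initial weight. *)
Lemma run_exp_init n mu Q K (g : S -> R) : @stochastic n Q K ->
  run_exp mu Q K (fun w => g (run_state w 0)) = \sum_s mu s * g s.
Proof.
elim: n mu Q K g => [|n IHn] mu Q K g QK1.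
  rewrite /run_exp -(pair_bigA _ (fun (f : {ffun 'I_0 -> X}) s =>
    run_weight mu Q K (f, s) * g (run_state (f, s) 0))) /=.
  rewrite [LHS](big_pred1 (@ffun0 'I_0 (fun=> X) (card_ord 0))).
    apply: eq_bigr => s _.
    by rewrite /run_weight big_ord0 mulr1 /run_state insubN.
  by move=> f; apply/esym/eqP/ffunP=> -[].
rewrite (run_exp_recl (fun x => g (st x)) (fun=> 1)); last first.
  by move=> x w; rewrite run_state_cons0 mulr1.
rewrite (IHn _ _ _ (fun=> 1)); last exact: stochastic_shift.
have [Q1 K1] := QK1.
rewrite push_mass // sum_by_state; apply: eq_bigr => s _.
rewrite -[RHS]mulr1 -(Q1 ord0 s) mulr_sumr; apply: eq_bigr => x /eqP <-.
by rewrite mulrA mulrAC.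
Qed.

Lemma run_exp_head n mu Q K (f : X -> R) : @stochastic n.+1 Q K ->
  run_exp mu Q K (fun w => f (w.1 ord0)) =
  \sum_x mu (st x) * (Q ord0 x * f x).
Proof.
move=> QK1; rewrite (run_exp_recl (f) (fun=> 1)); last first.
  by move=> x w; rewrite run_consE0 mulr1.
rewrite (run_exp_init _ (fun=> 1)); last exact: stochastic_shift.
exact/push_mass/QK1.2.
Qed.

(** The chain rule at time t: given the current state, the current pair is
    distributed according to [Q t].  Head removal reduces t to 0. *)
Lemma run_exp_pair n mu Q K (t : 'I_n) (f : X -> R) : stochastic Q K ->
  run_exp mu Q K (fun w => f (w.1 t)) =
  run_exp mu Q K
    (fun w => \sum_(x | st x == run_state w t) Q t x * f x).
Proof.
elim: n mu Q K t => [|n IHn] mu Q K t QK1; first by case: t.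
case: (unliftP ord0 t) => [t'|] ->.
  rewrite (run_exp_recl (fun=> 1) (fun w => f (w.1 t'))); last first.
    by move=> x w; rewrite run_consES mul1r.
  rewrite IHn; last exact: stochastic_shift.
  by apply/esym/(run_exp_recl (fun=> 1)) => x w; rewrite run_state_consS mul1r.
rewrite run_exp_head // (run_exp_init _ (fun s =>
  \sum_(x | st x == s) Q ord0 x * f x)) //.
rewrite sum_by_state; apply: eq_bigr => s _; rewrite mulr_sumr.
by apply: eq_bigr => x /eqP ->.
Qed.

(** The Markov property at time t: given the current pair, the next state is
    distributed according to [K t]. *)
Lemma run_exp_next n mu Q K (t : 'I_n) (g : S -> R) : stochastic Q K ->
  run_exp mu Q K (fun w => g (run_state w t.+1)) =
  run_exp mu Q K (fun w => \sum_s K t (w.1 t) s * g s).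
Proof.
elim: n mu Q K t => [|n IHn] mu Q K t QK1; first by case: t.
case: (unliftP ord0 t) => [t'|] ->.
  rewrite (run_exp_recl (fun=> 1)
    (fun w => g (run_state w t'.+1))); last first.
    by move=> x w; rewrite run_state_consS mul1r.
  rewrite IHn; last exact: stochastic_shift.
  by apply/esym/(run_exp_recl (fun=> 1)) => x w; rewrite run_consES mul1r.
rewrite (run_exp_recl (fun=> 1)
    (fun w => g (run_state w 0))); last first.
  by move=> x w; rewrite run_state_consS mul1r.
rewrite (run_exp_init _ g); last exact: stochastic_shift.
rewrite sum_push (run_exp_head _ (fun x => \sum_s K ord0 x s * g s)) //.
by apply: eq_bigr => x _; rewrite mulr1 mulrA.
Qed.

End Chain.

(** * Frequencies of a policy *)
Lemma sum_indicator (R : pzSemiRingType) (I : finType) (P : pred I)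
    (F : I -> R) i :
  \sum_(j | P j) F j * (j == i)%:R = if P i then F i else 0.
Proof.
rewrite big_mkcond (bigD1 i) //= big1 ?addr0 ?eqxx ?mulr1 // => j /negPf ->.
by rewrite mulr0 if_same.
Qed.

Lemma sum_scale_law (R : pzRingType) (V : lmodType R) (W Y : finType)
    (p : W -> R) (f : W -> Y) (h : Y -> V) :
  \sum_w p w *: h (f w) = \sum_y (\sum_(w | f w == y) p w) *: h y.
Proof.
rewrite (partition_big f predT) //=; apply: eq_bigr => y _.
by rewrite scaler_suml; apply: eq_bigr => w /eqP ->.
Qed.

Section Policy.
Variables (R : realType) (M : vMDP R).
Implicit Types (pi : policy M) (x : freq M).

Definition pair_rule pi (t : 'I_(horizon M).-1) (y : sapair M) : R :=
  rule pi t (tagged y).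

Definition pair_trans (t : 'I_(horizon M).-1) (y : sapair M) :=
  trans t (tagged y).

Lemma sum_pair (V : nmodType) (F : sapair M -> V) :
  \sum_y F y = \sum_s \sum_(a < nact s) F (existT _ s a).
Proof.
by rewrite sig_big_dep /=; apply: eq_bigr => -[s a].
Qed.

Lemma sum_pair_state (s : 'I_(nstates M)) (F : sapair M -> R) :
  \sum_(y | tag y == s) F y = \sum_(a < nact s) F (existT _ s a).
Proof.
rewrite big_mkcond sum_pair (bigD1 s) //= [X in _ + X]big1 ?addr0; last first.
  by move=> s' /negPf ss'; rewrite big1 // => a _; rewrite ss'.
by apply: eq_bigr => a _; rewrite eqxx.
Qed.

Lemma policy_stochastic pi : stochastic tag (pair_rule pi) pair_trans.
Proof.
split=> [t s|t y]; last exact: trans_sum1.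
by rewrite sum_pair_state; apply: rule_sum1.
Qed.

(** [traj_prob] is by computation the weight of a chain on state-action pairs,
    so that the results on chains apply to it. *)
Lemma probE pi (E : pred (traj M)) :
  prob pi E = run_exp tag (@init R M) (pair_rule pi) pair_trans
    (fun w => (E w)%:R).
Proof.
rewrite /prob big_mkcond; apply: eq_bigr => w _.
by case: (E w); rewrite ?mulr1 ?mulr0.
Qed.

Lemma prob_starts_in pi j : prob pi (@starts_in R M j) = init j.
Proof.
rewrite probE (run_exp_init _ (fun s => (s == j)%:R)).
  by rewrite sum_indicator.
exact: policy_stochastic.
Qed.

Definition state_is (n : nat) (s : 'I_(nstates M)) : pred (traj M) :=
  fun w => state_at w n == s.

Lemma prob_visits pi (t : 'I_(horizon M).-1) s (a : 'I_(nact s)) :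
  prob pi (visits t a) = prob pi (state_is t s) * rule pi t a.
Proof.
rewrite !probE (run_exp_pair _ _ (fun y => (y == existT _ s a)%:R)); last first.
  exact: policy_stochastic.
rewrite [in RHS]/run_exp mulr_suml; apply: eq_bigr => w _.
rewrite sum_indicator /= -[RHS]mulrA; congr (_ * _).
by rewrite eq_sym -[run_state _ w t == s]/(state_is t s w); case: state_is;
  rewrite ?mul0r ?mul1r.
Qed.

Lemma prob_state_next pi (t : 'I_(horizon M).-1) j :
  prob pi (state_is t.+1 j) =
  \sum_s \sum_(a < nact s) trans t a j * prob pi (visits t a).
Proof.
rewrite probE (run_exp_next _ _ (fun s => (s == j)%:R)); last first.
  exact: policy_stochastic.
rewrite -(sum_pair (fun y => trans t (tagged y) j *
  prob pi (fun w : traj M => w.1 t == y))).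
transitivity (\sum_w traj_prob pi w * pair_trans t (w.1 t) j).
  by apply: eq_bigr => w _; rewrite sum_indicator.
rewrite (partition_big (fun w : traj M => w.1 t) predT) //=.
apply: eq_bigr => y _; rewrite mulr_sumr; apply: eq_bigr => w /eqP <-.
exact: mulrC.
Qed.

(** Averaging over the initial state undoes the conditioning, because the
    events S_1 = j partition the trajectories and have mass [init j] > 0. *)
Lemma total_prob pi (E : pred (traj M)) :
  \sum_j init j * cond_prob pi E (@starts_in R M j) = prob pi E.
Proof.
rewrite [RHS](partition_big (fun w => state_at w 0) predT) //=.
apply: eq_bigr => j _; rewrite /cond_prob prob_starts_in.
by rewrite mulrCA mulfV ?mulr1 // gt_eqF // init_gt0.
Qed.

Lemma xdec_freq_of pi t s (a : 'I_(nact s)) :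
  xdec (freq_of pi) t a = prob pi (visits t a).
Proof. exact: total_prob. Qed.

Lemma xterm_freq_of pi s : xterm (freq_of pi) s = prob pi (@ends_in R M s).
Proof. exact: total_prob. Qed.

Lemma vMDP_objectiveE pi :
  vMDP_objective pi = \sum_w traj_prob pi w *: total_reward w.
Proof.
rewrite [RHS](partition_big (fun w => state_at w 0) predT) //=.
apply: eq_bigr => j _; rewrite /value /cond_exp prob_starts_in scalerA.
by rewrite mulfV ?scale1r // gt_eqF // init_gt0.
Qed.

(** Each summand of the total reward is a function of one coordinate, hence its
    expectation is a sum against the law of that coordinate. *)
Lemma vLP_objective_freq_of pi :
  vLP_objective (freq_of pi) = vMDP_objective pi.
Proof.
rewrite vMDP_objectiveE /vLP_objective.
under [RHS]eq_bigr do rewrite scalerDr scaler_sumr.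
rewrite big_split [X in _ = X + _]exchange_big; congr (_ + _).
  apply: eq_bigr => t _.
  rewrite (sum_scale_law _ (fun w : traj M => w.1 t)
    (fun y => reward t (tagged y))) sum_pair.
  by do 2![apply: eq_bigr => ? _]; rewrite xdec_freq_of.
rewrite (sum_scale_law _ (fun w : traj M => state_at w (horizon M).-1)).
by apply: eq_bigr => s _; rewrite xterm_freq_of.
Qed.

Lemma traj_prob_ge0 pi w : 0 <= traj_prob pi w.
Proof.
apply: mulr_ge0; first exact/ltW/init_gt0.
by apply: prodr_ge0 => t _; rewrite mulr_ge0 ?rule_ge0 ?trans_ge0.
Qed.

Lemma sum_xdec_freq_of pi (t : 'I_(horizon M).-1) j :
  \sum_(a < nact j) xdec (freq_of pi) t a = prob pi (state_is t j).
Proof.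
under eq_bigr do rewrite xdec_freq_of prob_visits.
by rewrite -mulr_sumr rule_sum1 mulr1.
Qed.

Lemma freq_of_feasible pi : vLP_feasible (freq_of pi).
Proof.
have next (t : 'I_(horizon M).-1) j : prob pi (state_is t.+1 j) =
    \sum_s \sum_(a < nact s) trans t a j * xdec (freq_of pi) t a.
  rewrite prob_state_next.
  by do 2![apply: eq_bigr => ? _]; rewrite xdec_freq_of.
split=> [t s a|s|t j t0|t t' j tt'|t j tT].
- by rewrite xdec_freq_of sumr_ge0 // => w _; apply: traj_prob_ge0.
- by rewrite xterm_freq_of sumr_ge0 // => w _; apply: traj_prob_ge0.
- by rewrite sum_xdec_freq_of t0; apply: prob_starts_in.
- by rewrite sum_xdec_freq_of tt' next.
- by rewrite xterm_freq_of -next tT.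
Qed.

(** * The policy of a feasible point *)
Section PolicyOf.
Variables (x : freq M) (Px : vLP_constraints x).

(** Where x puts no mass on the state, the ratio is meaningless and an arbitrary
    distribution is needed: the point mass at the first action is taken. *)
Definition freq_rule (t : 'I_(horizon M).-1) s (a : 'I_(nact s)) : R :=
  let m := \sum_(b < nact s) xdec x t b in
  if m == 0 then (a == Ordinal (nact_ge1 s))%:R else xdec x t a / m.

Lemma freq_rule_ge0 t s (a : 'I_(nact s)) : 0 <= freq_rule t a.
Proof.
have x_ge0 := xdec_ge0 Px t; rewrite /freq_rule; case: ifP => _.
  exact: ler0n.
by rewrite divr_ge0 // sumr_ge0.
Qed.

Lemma freq_rule_sum1 t s : \sum_(a < nact s) freq_rule t a = 1.
Proof.
rewrite /freq_rule; case: eqP => [_|/eqP m0]; last by rewrite -mulr_suml mulfV.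
by under eq_bigr do rewrite -[_%:R]mul1r; rewrite sum_indicator.
Qed.

Definition policy_of := Build_policy freq_rule_ge0 freq_rule_sum1.

(** On a state without mass, nonnegativity forces every component of x to
    vanish there, so x disintegrates along the rule whatever the choice. *)
Lemma xdec_freq_rule t s (a : 'I_(nact s)) :
  xdec x t a = (\sum_(b < nact s) xdec x t b) * freq_rule t a.
Proof.
rewrite /freq_rule; case: eqP => [m0|/eqP m0]; last by rewrite mulrC divfK.
rewrite m0 mul0r; apply/eqP.
have /eqP := m0; rewrite psumr_eq0; last by move=> b _; apply: xdec_ge0.
by move/allP/(_ a); rewrite mem_index_enum; apply.
Qed.

(** Both sides disintegrate along the same rule, so it is enough to compare
    state marginals; these agree at time 0 and satisfy the same recursion. *)
Lemma xdec_freq_of_policy_of t s (a : 'I_(nact s)) :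
  xdec (freq_of policy_of) t a = xdec x t a.
Proof.
have Py := freq_of_feasible policy_of.
suff mE (t' : 'I_(horizon M).-1) j :
    prob policy_of (state_is t' j) = \sum_(b < nact j) xdec x t' b.
  by rewrite xdec_freq_of prob_visits mE -xdec_freq_rule.
rewrite -sum_xdec_freq_of; case: t' => n; elim: n j => [|n IHn] j ltn.
  by rewrite !balance_init.
rewrite !(balance_step _ (t := Ordinal (ltnW ltn))) //.
do 2![apply: eq_bigr => ? _]; congr (_ * _).
by rewrite xdec_freq_of prob_visits -sum_xdec_freq_of IHn -xdec_freq_rule.
Qed.

Lemma vMDP_objective_policy_of :
  vMDP_objective policy_of = vLP_objective x.
Proof.
have [Py ltT] : vLP_constraints (freq_of policy_of) /\
    ((horizon M).-2 < (horizon M).-1)%N.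
  split; first exact: freq_of_feasible.
  by case: (horizon M) (horizon_ge2 M) => [|[]].
rewrite -vLP_objective_freq_of; congr (_ + _).
  by do 3![apply: eq_bigr => ? _]; rewrite xdec_freq_of_policy_of.
have tT : (Ordinal ltT).+1 = (horizon M).-1
  by rewrite /= prednK // (leq_trans _ ltT).
apply: eq_bigr => j _; rewrite !(balance_term _ _ tT) //; congr (_ *: _).
by do 2![apply: eq_bigr => ? _]; rewrite xdec_freq_of_policy_of.
Qed.

End PolicyOf.

End Policy.

Theorem theorem3p10 (R : realType) (M : vMDP R) :
  value_set (@vLP_feasible R M) (@vLP_objective R M) =
    value_set [set: policy M] (@vMDP_objective R M) /\
  (forall pi : policy M,
    vLP_feasible (freq_of pi) /\
    (efficient_policy pi <->
     efficient_solution (@vLP_feasible R M) (@vLP_objective R M)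
       (freq_of pi))).
Proof.
have VE : value_set (@vLP_feasible R M) (@vLP_objective R M) =
    value_set [set: policy M] (@vMDP_objective R M).
  apply/seteqP; split=> v.
    move=> [x Px <-]; exists (policy_of Px) => //.
    exact: vMDP_objective_policy_of.
  move=> [pi _ <-]; exists (freq_of pi); first exact: freq_of_feasible.
  exact: vLP_objective_freq_of.
split=> // pi; have Ppi := freq_of_feasible pi; split=> //.
rewrite /efficient_policy /efficient_solution VE vLP_objective_freq_of.
by split=> -[].
Qed.
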